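(* Let $R$ be a finite Frobenius ring, let $V=R^n$, and let $G$ be a finite permutation group on the coordinates of $V$. Let $H$ be a subgroup of $G$ such that $|H|$ has an inverse in $R$. If $C$ is a (left or right) $G$-code of length $n$ over $R$, then $${}^{\perp_H}(C\theta_H) = \bigl(({}^{\perp}C)\theta_H\bigr) M_H,$$ where $M_H$ is the $H$-orbit length matrix.
   Context: A finite (associative, unital) ring $R$ is Frobenius if $R/\mathrm{Rad}(R)\cong \mathrm{Soc}(R_R)$ as right $R$-modules and $R/\mathrm{Rad}(R)\cong\mathrm{Soc}({}_RR)$ as left $R$-modules. $R$ need not be commutative. On $V=R^n$ put $(u,v):=u_1v_1+\cdots+u_nv_n$. A permutation group $G$ on $\{1,\dots,n\}$ acts on $V$ on the right by $(vg)_i = v_{ig^{-1}}$. A left (right) $G$-code is a left (right) $R$-submodule $C$ of $V$ with $Cg\subseteq C$ for all $g\in G$. ''$|H|$ has an inverse in $R$'' means $|H|\cdot 1_R$ is a unit. Define $v\theta_H:=\frac1{|H|}\sum_{h\in H}vh$ for $v\in V$ and $X\theta_H:=\{v\theta_H:v\in X\}$ for $X\subseteq V$. For a submodule $X\subseteq V$, ${}^{\perp}X:=\{u\in V:(u,v)=0\text{ for all }v\in X\}$. Let $H_V(\alpha_1),\dots,H_V(\alpha_t)$ be the orbits of $H$ on $\{1,\dots,n\}$, $m_i$ the length (cardinality) of $H_V(\alpha_i)$, and $\overline{H_V(\alpha_i)}\in V$ the vector with entry $1$ at the positions in $H_V(\alpha_i)$ and $0$ elsewhere. Every $u\in V\theta_H$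 is uniquely $u=\sum_{i=1}^t u_i\overline{H_V(\alpha_i)}$ with $u_i\in R$. The $H$-inner product on $V\theta_H$ is $(u,v)_H:=\sum_{i=1}^t u_iv_i$, and for a submodule $X\subseteq V\theta_H$, ${}^{\perp_H}X:=\{v\in V\theta_H:(v,u)_H=0\text{ for all }u\in X\}$. The $H$-orbit length matrix is $M_H:=\mathrm{diag}(\ell_1,\dots,\ell_n)$ with $\ell_j=m_i$ if $j\in H_V(\alpha_i)$; for a set $Y\subseteq V$ of row vectors, $YM_H:=\{yM_H:y\in Y\}$. *)

(* Defs.v *)
From HB Require Import structures.
From mathcomp Require Import all_boot all_order all_fingroup all_algebra.

Set Implicit Arguments.
Unset Strict Implicit.
Unset Printing Implicit Defensive.

Import GRing.Theory generic_quotient.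
Local Open Scope ring_scope.
Local Open Scope quotient_scope.

(* Without these, R^c : finNzRingType elaborates to R itself: R^c unfolds. *)
HB.instance Definition _ (R : finType) := Finite.on R^c.
HB.instance Definition _ (R : finNzRingType) := FinRing.NzRing.on R^c.
HB.instance Definition _ (R : finUnitRingType) := FinRing.UnitRing.on R^c.

Section Frobenius.
Variable R : finNzRingType.
Implicit Types I J : {set R}.

Definition left_ideal I :=
  (0 \in I) && [forall a, forall x in I, forall y in I, a * x + y \in I].

Definition maximal_left_ideal I := maxset [pred J | left_ideal J && (J != setT)] I.
Definition minimal_left_ideal I := minset [pred J | left_ideal J && (J != [set 0])] I.

Definition jacobson : {set R} := \bigcap_(I | maximal_left_ideal I) I.

Definition left_socle : {set R} :=
  [set \sum_(I | minimal_left_ideal I) f I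
    | f : {ffun {set R} -> R} & [forall I, minimal_left_ideal I ==> (f I \in I)]].

Lemma left_idealP I :
  reflect (GRing.submod_closed (I : {set R^o})) (left_ideal I).
Proof.
apply: (iffP andP) => -[I0 H]; split=> //.
  by move=> a x y xI yI; move/forallP/(_ a)/forall_inP/(_ x xI)/forall_inP: H; apply.
apply/forallP => a; apply/forall_inP => x xI; apply/forall_inP => y yI.
exact: H.
Qed.

Lemma jacobsonP x :
  reflect (forall a, exists b, b * (1 - a * x) = 1) (x \in jacobson).
Proof.
apply: (iffP bigcapP) => [xJ a | xU I maxI].
  pose I : {set R} := [set b * (1 - a * x) | b : R].
  have idI : left_ideal I.
    apply/left_idealP; split; first by apply/imsetP; exists 0; rewrite ?mul0r.
    move=> c _ _ /imsetP [b _ ->] /imsetP [d _ ->].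
    by apply/imsetP; exists (c * b + d); rewrite // /GRing.scale /= mulrDl mulrA.
  have [IT | IT] := eqVneq I setT.
    have: 1 \in I by rewrite IT inE.
    by case/imsetP => b _ bE; exists b.
  case: (@maxset_exists _ [pred J | left_ideal J && (J != setT)] I _) => [|K maxK sIK].
    by rewrite /= idI.
  have /maxsetP [/= /andP [/left_idealP [K0 KL] KT] _] := maxK.
  case/negP: KT; apply/eqP/setP => y; rewrite inE.
  have K1 : 1 \in K.
    have -> : 1 = a * x + (1 - a * x) by rewrite addrC subrK.
    apply: KL; first exact: xJ.
    by apply: (subsetP sIK); apply/imsetP; exists 1; rewrite ?mul1r.
  by have := KL y 1 0 K1 K0; rewrite addr0 /GRing.scale /= mulr1.
have /maxsetP [/= /andP [/left_idealP [I0 IL] IT] maxi] := maxI.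
apply: contraT => xI.
pose K : {set R} := [set u | [exists a, u - a * x \in I]].
have KP u : reflect (exists a, u - a * x \in I) (u \in K).
  by rewrite inE; apply: existsP.
have idK : left_ideal K.
  apply/left_idealP; split; first by apply/KP; exists 0; rewrite mul0r subr0.
  move=> c u v /KP [a ua] /KP [b vb]; apply/KP; exists (c * a + b).
  have -> : c *: (u : R^o) + v - (c * a + b) * x = c *: (u - a * x : R^o) + (v - b * x).
    by rewrite /GRing.scale /= mulrBr mulrDl opprD mulrA addrACA.
  exact: IL.
have sIK : I \subset K.
  by apply/subsetP => u uI; apply/KP; exists 0; rewrite mul0r subr0.
have [KT | KT] := eqVneq K setT; last first.
  have KI : K = I by apply: maxi; rewrite //= idK.
  by case/negP: xI; rewrite -KI; apply/KP; exists 1; rewrite mul1r subrr.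
have /KP [a aI] : 1 \in K by rewrite KT inE.
have [b bE] := xU a.
case/negP: IT; apply/eqP/setP => y; rewrite inE.
have := IL (y * b) _ 0 aI I0.
by rewrite addr0 /GRing.scale /= -mulrA bE mulr1.
Qed.

Definition in_jacobson : {pred R^o} := [pred x | x \in jacobson].
Definition in_left_socle : {pred R^o} := [pred x | x \in left_socle].

Fact in_jacobson_closed : GRing.submod_closed in_jacobson.
Proof.
split.
  apply/bigcapP => I /maxsetP [] /= /andP [/left_idealP [I0 _] _] _; exact: I0.
move=> a x y /bigcapP xJ /bigcapP yJ; apply/bigcapP => I maxI.
have /maxsetP [/= /andP [/left_idealP [_ IL] _] _] := maxI.
by apply: IL; [exact: xJ | exact: yJ].
Qed.

Fact in_left_socle_closed : GRing.submod_closed in_left_socle.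
Proof.
split.
  apply/imsetP; exists [ffun=> 0].
    rewrite inE; apply/forallP => I; apply/implyP.
    by case/minsetP => /= /andP [/left_idealP [I0 _] _] _; rewrite ffunE.
  by rewrite big1 // => I _; rewrite ffunE.
move=> a _ _ /imsetP [f + ->] /imsetP [g + ->]; rewrite !inE => Hf Hg.
apply/imsetP; exists [ffun I => a * f I + g I].
  rewrite inE; apply/forallP => I; apply/implyP => minI.
  have /minsetP [/= /andP [/left_idealP [_ IL] _] _] := minI.
  move/forallP/(_ I)/implyP/(_ minI): Hf => fI.
  move/forallP/(_ I)/implyP/(_ minI): Hg => gI.
  by rewrite ffunE; apply: IL.
rewrite /GRing.scale /= mulr_sumr -big_split; apply: eq_bigr => I _.
by rewrite ffunE.
Qed.

HB.instance Definition _ :=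
  GRing.isSubmodClosed.Build R R^o in_jacobson in_jacobson_closed.
HB.instance Definition _ :=
  GRing.isSubmodClosed.Build R R^o in_left_socle in_left_socle_closed.

Definition jacobson_quot := Quotient.quot in_jacobson.
HB.instance Definition _ := GRing.Zmodule.on jacobson_quot.
HB.instance Definition _ : EqQuotient _ _ jacobson_quot := EqQuotient.on jacobson_quot.

Definition jacobson_quot_scale (a : R) (x : jacobson_quot) : jacobson_quot :=
  \pi_jacobson_quot (a *: repr x).

Fact jacobson_quot_scale_pi a (x : R^o) :
  jacobson_quot_scale a (\pi_jacobson_quot x) = \pi_jacobson_quot (a *: x).
Proof.
apply/eqP; have /= <- := Quotient.idealrBE in_jacobson (a *: repr (\pi_jacobson_quot x)) (a *: x).
rewrite -scalerBr rpredZ // Quotient.idealrBE; apply/eqP; exact: reprK.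
Qed.

Fact jacobson_quot_piD (x y : R^o) :
  \pi_jacobson_quot (x + y) = \pi_jacobson_quot x + \pi_jacobson_quot y.
Proof. exact: Quotient.pi_add. Qed.

Fact jacobson_quot_scaleA a b x :
  jacobson_quot_scale a (jacobson_quot_scale b x) = jacobson_quot_scale (a * b) x.
Proof.
elim/quotW: x => x.
by rewrite (jacobson_quot_scale_pi b x) !jacobson_quot_scale_pi scalerA.
Qed.

Fact jacobson_quot_scale1 : left_id 1 jacobson_quot_scale.
Proof. by elim/quotW=> x; rewrite jacobson_quot_scale_pi scale1r. Qed.

Fact jacobson_quot_scaleDr : right_distributive jacobson_quot_scale +%R.
Proof.
move=> a; elim/quotW=> x; elim/quotW=> y.
by rewrite -jacobson_quot_piD !jacobson_quot_scale_pi scalerDr jacobson_quot_piD.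
Qed.

Fact jacobson_quot_scaleDl x : {morph jacobson_quot_scale^~ x : a b / a + b}.
Proof.
elim/quotW: x => x a b.
by rewrite !jacobson_quot_scale_pi scalerDl jacobson_quot_piD.
Qed.

HB.instance Definition _ := GRing.Zmodule_isLmodule.Build R jacobson_quot
  jacobson_quot_scaleA jacobson_quot_scale1
  jacobson_quot_scaleDr jacobson_quot_scaleDl.

Record left_socle_mod :=
  LeftSocleMod { left_socle_val :> R^o; _ : left_socle_val \in in_left_socle }.
HB.instance Definition _ := [isSub for left_socle_val].
HB.instance Definition _ := [Choice of left_socle_mod by <:].
HB.instance Definition _ := [SubChoice_isSubLmodule of left_socle_mod by <:].

Definition left_frobenius : Prop :=
  exists f : {linear jacobson_quot -> left_socle_mod}, bijective f.

End Frobenius.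

Lemma left_inv_right_inv (R : finNzRingType) (b y : R) : b * y = 1 -> y * b = 1.
Proof.
move=> byE; have yI : injective ( *%R y).
  by move=> u v /(congr1 ( *%R b)); rewrite !mulrA byE !mul1r.
have [g _ gK] := injF_bij yI.
have yc : y * g 1 = 1 := gK 1.
by rewrite -[b]mulr1 -[X in b * X]yc (mulrA b) byE mul1r yc.
Qed.

Lemma inv_one_subMC (R : finNzRingType) (a x b : R) :
  (1 - a * x) * b = 1 -> exists c, c * (1 - x * a) = 1.
Proof.
move=> bE; exists (1 + x * b * a); apply: left_inv_right_inv.
have -> : (1 - x * a) * (1 + x * b * a) = 1 - x * a + x * ((1 - a * x) * b) * a.
  by rewrite mulrDr mulr1 mulrBl mul1r mulrBl mul1r mulrBr mulrBl !mulrA.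
by rewrite bE mulr1 subrK.
Qed.

(* jacobson R^c is the intersection of the maximal right ideals of R. *)
Lemma jacobson_conv (R : finNzRingType) : jacobson R^c = jacobson R :> {set R}.
Proof.
apply/setP => x; apply/(@jacobsonP R^c)/(@jacobsonP R) => xU a;
  have [b bE] := xU a.
  exact: (@inv_one_subMC R x a b bE).
have [c cE] := inv_one_subMC (left_inv_right_inv bE).
by exists c; exact: (left_inv_right_inv cE).
Qed.

(* Left R^c-modules are right R-modules, so the second half is
   R / Rad(R) ~ Soc(R_R) as right R-modules. *)
Definition frobenius (R : finNzRingType) : Prop :=
  left_frobenius R /\ left_frobenius R^c.

Section Codes.
Variables (R : finUnitRingType) (n : nat).
Local Notation V := 'rV[R]_n.
Implicit Types (G H : {group 'S_n}) (X C : {set V}) (u v : V).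

Definition dot u v : R := \sum_i u 0 i * v 0 i.

(* Rows v g with (v g)_i = v_(i g^-1); permutations compose left to right, so
   this is a right action. *)
Definition vact v (g : 'S_n) : V := \row_i v 0 (g^-1%g i).

Definition left_submodule C : Prop := GRing.submod_closed C.

(* The R^c-module structure on rows is scaling by R on the right. *)
Definition right_submodule C : Prop :=
  GRing.submod_closed (C : {set 'rV[R^c]_n}).

Definition G_stable G C : Prop :=
  forall g v, g \in G -> v \in C -> vact v g \in C.

Definition left_code G C : Prop := left_submodule C /\ G_stable G C.
Definition right_code G C : Prop := right_submodule C /\ G_stable G C.

Definition lperp X : {set V} := [set u | [forall v in X, dot u v == 0]].

Definition theta H v : V := (#|H|%:R)^-1 *: \sum_(h in H) vact v h.

Definition orbits H : {set {set 'I_n}} := [set orbit 'P H i | i : 'I_n].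

Definition orbit_vec (O : {set 'I_n}) : V := \row_i (i \in O)%:R.

(* The u_i with u = \sum_i u_i \overline{H_V(alpha_i)}, indexed by the orbits
   themselves; the values off the orbits are irrelevant, and a vector without
   such an expansion, i.e. outside the image of theta H, gets 0. *)
Definition orbit_coef H u : {ffun {set 'I_n} -> R} :=
  odflt [ffun=> 0]
    [pick c : {ffun {set 'I_n} -> R} |
      u == \sum_(O in orbits H) c O *: orbit_vec O].

Definition dot_orb H u v : R :=
  \sum_(O in orbits H) orbit_coef H u O * orbit_coef H v O.

Definition lperp_orb H X : {set V} :=
  [set v in theta H @: setT | [forall u in X, dot_orb H v u == 0]].

Definition orbit_length_mx H : 'M[R]_n :=
  diag_mx (\row_j #|orbit 'P H j|%:R).

End Codes.

(* Main.v *)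
(** Every [H]-invariant vector is constant on orbits, and [M_H] weighs each
    orbit by its length, so [(w M_H, v)_H = (w, v)] for invariant [w] and [v].
    Averaging is self-adjoint for [( , )] and fixes invariant vectors, hence
    [(w M_H, c theta)_H = (w, c theta) = (w, c)] for invariant [w].  As orbit
    lengths divide [|H|], the matrix [M_H] is invertible on invariant vectors,
    so the orthogonal of [C theta] is [M_H] applied to the invariant vectors of
    the orthogonal of [C]; these are its averages because [C] is [H]-stable. *)
Require Import Defs.
From mathcomp Require Import all_boot all_order all_fingroup all_algebra.
Import GRing.Theory.
Local Open Scope ring_scope.

Section Averaging.
Set Implicit Arguments.
Unset Strict Implicit.
Variables (R : finUnitRingType) (n : nat) (H : {group 'S_n}).
Local Notation V := 'rV[R]_n.
Implicit Types (u v w : V) (g h : 'S_n) (i j : 'I_n).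

Lemma dot_sumr (I : finType) (P : pred I) u (F : I -> V) :
  dot u (\sum_(k | P k) F k) = \sum_(k | P k) dot u (F k).
Proof.
rewrite exchange_big; apply: eq_bigr => i _.
by rewrite summxE mulr_sumr.
Qed.

Lemma dot_suml (I : finType) (P : pred I) (F : I -> V) v :
  dot (\sum_(k | P k) F k) v = \sum_(k | P k) dot (F k) v.
Proof.
rewrite exchange_big; apply: eq_bigr => i _.
by rewrite summxE mulr_suml.
Qed.

Lemma dotZl a u v : dot (a *: u) v = a * dot u v.
Proof. by rewrite mulr_sumr; apply: eq_bigr => i _; rewrite mxE mulrA. Qed.

(** Permuting coordinates preserves [dot], so the adjoint of [g] is its inverse. *)
Lemma dot_vact u v g : dot (vact u g) v = dot u (vact v g^-1%g).
Proof.
rewrite /dot (reindex_inj (@perm_inj _ g)); apply: eq_bigr => i _.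
by rewrite !mxE permK invgK.
Qed.

Lemma vactM v g h : vact (vact v g) h = vact v (g * h)%g.
Proof. by apply/rowP => i; rewrite !mxE invMg permM. Qed.

(** Natural multiples of 1 are central even when [R] is not commutative; this lets the factor
    [#|H|%:R^-1] pass the entries of the left argument of [dot]. *)
Lemma commr_natV k (a : R) : a * k%:R^-1 = k%:R^-1 * a.
Proof. exact/commrV/commr_nat. Qed.

Lemma dot_theta u v :
  dot u (theta H v) = #|H|%:R^-1 * \sum_(h in H) dot u (vact v h).
Proof.
rewrite -dot_sumr mulr_sumr; apply: eq_bigr => i _.
by rewrite mxE mulrA commr_natV mulrA.
Qed.

(** Moving each [h] across [dot] inverts it, and inversion permutes [H]. *)
Lemma dot_theta_adj u v : dot (theta H u) v = dot u (theta H v).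
Proof.
rewrite dot_theta dotZl dot_suml (reindex_inj invg_inj); congr (_ * _).
by apply: eq_big => [h|h _]; rewrite ?groupV // dot_vact invgK.
Qed.

Definition invariant v := forall h, h \in H -> vact v h = v.

Lemma theta_invariant v : invariant (theta H v).
Proof.
move=> h hH; apply/rowP => i; rewrite !mxE !summxE; congr (_ * _).
(* Right translation by [h] permutes [H]. *)
rewrite [RHS](reindex_inj (mulIg h)).
apply: eq_big => [g|g _]; first by rewrite groupMr.
by rewrite -vactM [RHS]mxE.
Qed.

Lemma invariant_orbit v i j :
  invariant v -> j \in orbit 'P H i -> v 0 j = v 0 i.
Proof.
move=> vH /orbitP [h hH <-].
by rewrite -{1}(vH h hH) mxE /= apermE permK.
Qed.

Lemma orbit_actE h i : h \in H -> orbit 'P H (h i) = orbit 'P H i.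
Proof. by move=> hH; apply/orbit_eqP; rewrite -apermE mem_orbit. Qed.

Lemma orbits_partition : partition (orbits H) [set: 'I_n].
Proof.
have -> : orbits H = orbit 'P H @: [set: 'I_n].
  by apply/setP => O; apply/imsetP/imsetP => -[i _ ->]; exists i.
by apply: orbit_partition; apply/actsP => h _ i; rewrite !inE.
Qed.

Lemma sum_orbits (F : 'I_n -> R) :
  \sum_i F i = \sum_(O in orbits H) \sum_(i in O) F i.
Proof.
have /and3P [/eqP cov tI _] := orbits_partition.
by rewrite -(big_trivIset _ tI) /= cov; apply: eq_bigl => i; rewrite inE.
Qed.

Lemma orbit_expansion (c : {ffun {set 'I_n} -> R}) i :
  (\sum_(O in orbits H) c O *: orbit_vec R O) 0 i = c (orbit 'P H i).
Proof.
rewrite summxE (bigD1 (orbit 'P H i)) ?imset_f //= !mxE orbit_refl mulr1.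
rewrite big1 ?addr0 // => _ /andP [/imsetP [j _ ->] /negP neq].
rewrite !mxE; case: (boolP (i \in _)) => [ij|]; rewrite ?mulr0 //.
by case: neq; apply/eqP/esym/orbit_eqP.
Qed.

Lemma orbit_coefE v i :
  invariant v -> orbit_coef H v (orbit 'P H i) = v 0 i.
Proof.
move=> vH; rewrite /orbit_coef; case: pickP => [c /eqP cE | /=].
  by rewrite [in RHS]cE orbit_expansion.
(* The choice cannot fail: the values of [v] at orbit representatives give an expansion. The default
   0 is reached only at the empty set, which is no orbit. *)
pose c : {ffun {set 'I_n} -> R} :=
  [ffun O : {set 'I_n} => oapp (v 0) (0 : R) [pick k in O]].
move/(_ c)/eqP; case; apply/rowP => j; rewrite orbit_expansion ffunE.
case: pickP => [k /(invariant_orbit vH) // | /(_ j)].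
by rewrite orbit_refl.
Qed.

Lemma mul_orbit_lengthE v i :
  (v *m orbit_length_mx R H) 0 i = v 0 i * #|orbit 'P H i|%:R.
Proof. by rewrite mul_mx_diag !mxE. Qed.

Lemma invariant_mul_orbit_length v :
  invariant v -> invariant (v *m orbit_length_mx R H).
Proof.
move=> vH h hH; apply/rowP => i; rewrite mxE !mul_orbit_lengthE.
by rewrite -{2}(vH h hH) mxE orbit_actE ?groupV.
Qed.

Lemma dot_orb_length u v : invariant u -> invariant v ->
  dot_orb H (u *m orbit_length_mx R H) v = dot u v.
Proof.
move=> uH vH; rewrite /dot sum_orbits; apply: eq_bigr => _ /imsetP [i _ ->].
rewrite !orbit_coefE ?mul_orbit_lengthE //; last exact: invariant_mul_orbit_length.
(* The summand is constant on the orbit, so the sum produces the orbit length as a factor. *)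
rewrite (eq_bigr (fun=> u 0 i * v 0 i)); last first.
  by move=> j ij; rewrite (invariant_orbit uH ij) (invariant_orbit vH ij).
by rewrite sumr_const mulr_natr mulrnAl.
Qed.

Hypothesis unitH : (#|H|%:R : R) \is a GRing.unit.

Lemma theta_id v : invariant v -> theta H v = v.
Proof.
move=> vH; rewrite /theta (eq_bigr _ vH) sumr_const -scaler_nat scalerA.
by rewrite mulVr // scale1r.
Qed.

Lemma unit_card_orbit i : (#|orbit 'P H i|%:R : R) \is a GRing.unit.
Proof.
have /dvdnP [k Hk] := dvdn_orbit 'P H i.
(* In a product of commuting elements that is a unit, both factors are units. *)
move: unitH; rewrite Hk natrM unitrM_comm; last exact: commr_nat.
by case/andP.
Qed.

Lemma invariant_div_orbit_length v : invariant v ->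
  exists2 w, invariant w & v = w *m orbit_length_mx R H.
Proof.
(* Dividing by the orbit length keeps invariance, since that length is constant along orbits. *)
move=> vH; exists (\row_i (v 0 i / #|orbit 'P H i|%:R)).
  move=> h hH; apply/rowP => i; rewrite !mxE orbit_actE ?groupV //.
  by rewrite -{2}(vH h hH) mxE.
by apply/rowP => i; rewrite mul_orbit_lengthE mxE divrK ?unit_card_orbit.
Qed.

(** Stated for an [H]-stable set, so that left and right codes are treated alike. *)
Lemma lperp_orb_theta (C : {set V}) : G_stable H C ->
  lperp_orb H (theta H @: C) =
    [set y *m orbit_length_mx R H | y in theta H @: lperp C].
Proof.
move=> CH; apply/setP => v; rewrite !inE; apply/andP/imsetP.
  case=> /imsetP [v' _ ->] /forall_inP perp.
  have [w wH vE] := invariant_div_orbit_length (theta_invariant v').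
  (* Being invariant, [w] is its own average, so it remains to show that [w] lies in [lperp C]. *)
  exists w => //; apply/imsetP; exists w; last by rewrite theta_id.
  rewrite inE; apply/forall_inP => c cC.
  have := perp _ (imset_f _ cC).
  rewrite vE dot_orb_length //; last exact: theta_invariant.
  by rewrite -dot_theta_adj theta_id.
case=> _ /imsetP [u + ->] ->; rewrite inE => /forall_inP uC.
have uH := theta_invariant u; split.
  apply/imsetP; exists (theta H u *m orbit_length_mx R H) => //.
  by rewrite [RHS]theta_id //; apply: invariant_mul_orbit_length.
apply/forall_inP => _ /imsetP [c cC ->]; have cH := theta_invariant c.
rewrite dot_orb_length // dot_theta_adj theta_id // dot_theta.
(* Each translate of [c] by [H] stays in [C], hence is orthogonal to [u]. *)
by rewrite big1 ?mulr0 // => h hH; apply/eqP/uC/CH.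
Qed.

End Averaging.

Theorem theorem3p3 (R : finUnitRingType) (n : nat) (G H : {group 'S_n})
    (C : {set 'rV[R]_n}) :
  frobenius R ->
  H \subset G ->
  (#|H|%:R : R) \is a GRing.unit ->
  left_code G C \/ right_code G C ->
  lperp_orb H (theta H @: C) =
    [set y *m orbit_length_mx R H | y in theta H @: lperp C].
Proof.
move=> _ sHG unitH codeC; apply: lperp_orb_theta => // h v hH.
by have [[_ CG] | [_ CG]] := codeC; apply/CG/(subsetP sHG).
Qed.
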